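(* For every real $\delta>0$ there exists an integer $K'(\delta)\geq1$ such that, for every integer $N\geq1$ and every $E\subseteq\mathbb{Z}_N^2$ satisfying $|E|\geq\delta N^2$, there exists a (positive) divisor $d\mid N$ with $d\leq K'(\delta)$ such that $$d\mathbb{Z}_N\subseteq\{u^2-v^2:(u,v)\in E-E\}.$$
   Context: $\mathbb{Z}_N=\mathbb{Z}/N\mathbb{Z}$ is the ring of integers modulo $N$. $E-E=\{a-b:a,b\in E\}\subseteq\mathbb{Z}_N^2$, and $u^2-v^2$ is computed in $\mathbb{Z}_N$. *)

(* Defs.v *)
From HB Require Import structures.
From mathcomp Require Import all_boot all_order all_algebra.
From mathcomp Require Import reals.

Set Implicit Arguments.
Unset Strict Implicit.
Unset Printing Implicit Defensive.

Import GRing.Theory.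
Local Open Scope ring_scope.

(* The library's ring 'Z_N is Z/2Z when N = 1. The alias below is Z/NZ for    *)
(* every N >= 1, including the zero ring for N = 1 (hence only a pzRingType). *)
(* Pitfall: Zmod 0 is also the zero ring.                                     *)
Definition Zmod (N : nat) : Type := 'I_N.-1.+1.

HB.instance Definition _ (N : nat) := FinRing.Zmodule.on (Zmod N).
HB.instance Definition _ (N : nat) :=
  GRing.Zmodule_isComPzRing.Build (Zmod N)
    (@Zp_mulA _) (@Zp_mulC _) (@Zp_mul1z _) (@Zp_mul_addl _).

Lemma card_Zmod (N : nat) : (0 < N)%N -> #|{: Zmod N}| = N.
Proof. by case: N => // n _; rewrite card_ord. Qed.

Definition diffset (N : nat) (E : {set Zmod N * Zmod N}) :
    {set Zmod N * Zmod N} :=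
  [set a - b | a : Zmod N * Zmod N in E, b : Zmod N * Zmod N in E].

Definition multiples (N d : nat) : {set Zmod N} :=
  [set d%:R * x | x : Zmod N].

(* Main.v *)
Require Import Defs.
From mathcomp Require Import all_boot all_order all_algebra all_field.
From mathcomp Require Import reals ring zify.

Import Order.TTheory GRing.Theory Num.Theory.
Local Open Scope ring_scope.

Set Implicit Arguments.
Unset Strict Implicit.

(** The value u^2 - v^2 at (u, v) = (x + y, y - x) is 4 x y.  Fix an integer
    Q >= 1, an exponent s and a residue m.  For every i <= s and every unit
    l of Z/N the pair x = Q^i l, y = Q^(s - i) m l^-1 gives the same value
    4 Q^s m.  If all these points, over all i and all l, equidistribute well
    enough, one of them lies in E - E, so that 4 Q^s m is represented for all
    m.  As (4 Q^s) Z/N = gcd(4 Q^s, N) Z/N, it is enough to choose Q and s in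
    terms of delta alone.

    Equidistribution is needed from one side only.  Let n + 1 > 1 / delta.  If
    the normalized Fourier coefficients of the family of points are all
    >= -1/n, while the trivial one is 1, then Parseval forces the family to
    meet E - E as soon as (n + 1) |E| > N^2 ([diffset_spectral]).
    The coefficient at a frequency is an average over i of Kloosterman sums
    S(c Q^i, d Q^(s - i)), where S(c, d) is the sum of e(c l + d l^-1) over
    the units l modulo N, and the lower bound is [kloo_progression].  Let P be
    a large constant, Q = P!, and for a prime p compare the exponents
    of p in the additive orders of the two arguments of S.

    - If some prime p > P divides one of the two orders, then S is small in
      absolute value, for all i ([kloo_large_prime]).  Averaging over
      the units l (1 + z T), with T^2 killing c and d and T c, T d of order
      dividing p, restricts the sum to the stationary points
      T c l = T d l^-1; that settles exponents >= 2, since a quadratic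
      congruence modulo p has at most two solutions.  When both exponents are
      at most 1, averaging over the p-component of the unit group leaves a
      Kloosterman sum modulo p, which is O(p^(3/4)) by Kloosterman's fourth
      moment argument ([kloo_fourth_moment]).

    - Otherwise only the primes p <= P matter.  As i grows, the exponent of p
      in the order of c Q^i strictly decreases down to 0 and that of
      d Q^(s - i) increases strictly once it is positive.  So for each p all
      but three values of i give exponents that are both 0, or are distinct
      with a maximum >= 2; in the second case there is no stationary point and
      S = 0.  Hence, with at most 3 (P + 1) exceptions, S(c Q^i, d Q^(s - i))
      is either 0 or the number of units, and no cancellation bound is needed
      for small primes: it is enough that s be large compared with P n. *)

(** * Additive characters of finite rings and Kloosterman sums *)

Section Characters.

Record faithful_char (R : finComPzRingType) (e : R -> algC) : Prop := {
  charD : {morph e : x y / x + y >-> x * y};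
  char_norm : forall x, `|e x| = 1;
  char_faithful : forall x, e x = 1 -> x = 0
}.

Variables (R : finComPzRingType) (e : R -> algC).
Hypothesis eP : faithful_char e.

Lemma char0 : e 0 = 1.
Proof.
have e0 : e 0 != 0 by rewrite -normr_eq0 (char_norm eP) oner_eq0.
by apply: (mulfI e0); rewrite -(charD eP) addr0 mulr1.
Qed.

Lemma charN x : e (- x) = (e x)^*.
Proof.
have ex : e x != 0 by rewrite -normr_eq0 (char_norm eP) oner_eq0.
apply: (mulfI ex); rewrite -(charD eP) subrr char0 -normCK (char_norm eP).
by rewrite expr1n.
Qed.

Lemma charMn x n : e (n%:R * x) = e x ^+ n.
Proof.
elim: n => [|n IH]; first by rewrite mul0r char0.
by rewrite exprS -IH -(charD eP) -addn1 natrD mulrDl mul1r addrC.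
Qed.

Lemma char_sum z : \sum_x e (x * z) = (if z == 0 then #|R|%:R else 0).
Proof.
case: eqP => [->|/eqP z0].
  under eq_bigr => x _ do rewrite mulr0 char0.
  by rewrite sumr_const.
(* The translation x -> x + 1 multiplies the sum by e z. *)
have H : e z * \sum_x e (x * z) = \sum_x e (x * z).
  rewrite [RHS](reindex_inj (addIr 1)) big_distrr /=.
  by apply: eq_bigr => x _; rewrite mulrDl mul1r (charD eP) mulrC.
apply/eqP; move/eqP: H; rewrite -subr_eq0 -{2}[\sum_x _]mul1r -mulrBl mulf_eq0.
case/orP => //; rewrite subr_eq0 => /eqP /(char_faithful eP) /eqP.
by rewrite (negPf z0).
Qed.

Definition dot (xi g : R * R) := xi.1 * g.1 + xi.2 * g.2.

Lemma dotDr xi g h : dot xi (g + h) = dot xi g + dot xi h.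
Proof. by rewrite /dot /=; ring. Qed.

Lemma dotBr xi g h : dot xi (g - h) = dot xi g - dot xi h.
Proof. by rewrite /dot /=; ring. Qed.

Lemma char_sum_dot g :
  \sum_xi e (dot xi g) = (if g == 0 then #|R|%:R ^+ 2 else 0).
Proof.
rewrite -(pair_bigA _ (fun x y => e (dot (x, y) g))) /=.
under eq_bigr => x _.
  under eq_bigr => y _ do rewrite /dot /= (charD eP).
  rewrite -big_distrr /= char_sum.
  over.
rewrite -big_distrl /= char_sum; case: g => a b /=.
rewrite -[(a, b) == 0]/((a == 0) && (b == 0)).
by case: (a == 0); case: (b == 0); rewrite ?mul0r ?mulr0 // -expr2.
Qed.

(** Parseval for the push-forward of the counting measure of [A] under [f]:
    the second moment of its Fourier transform counts coincidences of [f]. *)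
Lemma energy_identity (I : finType) (A : {set I}) (f : I -> R * R) :
  \sum_xi `|\sum_(i in A) e (dot xi (f i))| ^+ 2 =
    #|R|%:R ^+ 2 * #|[set t in setX A A | f t.1 == f t.2]|%:R.
Proof.
under eq_bigr => xi _.
  rewrite normCK rmorph_sum big_distrlr /= pair_big /=.
  under eq_bigr => t _ do rewrite -charN -(charD eP) -dotBr.
  over.
rewrite exchange_big /=.
under eq_bigr => t _ do rewrite char_sum_dot subr_eq0.
rewrite -big_mkcondr sumr_const /= -[LHS]mulr_natr; congr (_ * _%:R).
by apply: eq_card => -[i j]; rewrite !inE.
Qed.

(** Units are handled as pairs (l, l^-1).  This encoding makes sense in the zero
    ring too, and turns a Kloosterman sum into the Fourier transform of a
    set. *)
Definition unit_pairs : {set R * R} := [set u | u.1 * u.2 == 1].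

Lemma unit_pairsP (u : R * R) : reflect (u.1 * u.2 = 1) (u \in unit_pairs).
Proof. by rewrite inE; apply: eqP. Qed.

(** The unit [k] moves [u] along its hyperbola; the same map on frequencies is
    the adjoint action ([dot_mulp]). *)
Definition mulp (k u : R * R) : R * R := (u.1 * k.1, u.2 * k.2).

Lemma mulp_unit k u : k \in unit_pairs ->
  (mulp k u \in unit_pairs) = (u \in unit_pairs).
Proof.
move=> /unit_pairsP Hk; rewrite !inE /= [_ * (u.2 * _)]mulrACA Hk.
by rewrite mulr1.
Qed.

Lemma mulp_inj k : k \in unit_pairs -> injective (mulp k).
Proof.
move=> /unit_pairsP Hk [a b] [c d] [H1 H2].
have -> : a = c by rewrite -[a]mulr1 -Hk mulrA H1 -mulrA Hk mulr1.
have -> // : b = d.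
by rewrite -[b]mulr1 -Hk [k.1 * _]mulrC mulrA H2 -mulrA [k.2 * _]mulrC Hk mulr1.
Qed.

Lemma sum_unit_mulp (V : nmodType) (g : R * R -> V) k : k \in unit_pairs ->
  \sum_(u in unit_pairs) g (mulp k u) = \sum_(u in unit_pairs) g u.
Proof.
move=> Hk; rewrite [RHS](reindex_inj (mulp_inj Hk)) /=.
by apply: eq_bigl => u; rewrite mulp_unit.
Qed.

Definition kloosterman (c : R * R) : algC := \sum_(u in unit_pairs) e (dot c u).

Lemma dot_mulp c k u : dot c (mulp k u) = dot (mulp k c) u.
Proof. by rewrite /dot /=; ring. Qed.

Lemma kloo_mulp c k : k \in unit_pairs -> kloosterman (mulp k c) = kloosterman c.
Proof.
move=> Hk; rewrite /kloosterman -[RHS](sum_unit_mulp _ Hk).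
by apply: eq_bigr => u _; rewrite dot_mulp.
Qed.

Lemma kloo0 : kloosterman 0 = #|unit_pairs|%:R.
Proof.
rewrite /kloosterman; under eq_bigr => u _ do rewrite /dot /= !mul0r addr0 char0.
by rewrite sumr_const.
Qed.

(** The substitution l -> -l conjugates each term. *)
Lemma kloo_real c : kloosterman c \is Num.real.
Proof.
rewrite CrealE /kloosterman rmorph_sum /=; apply/eqP.
have opp_inj : injective (fun u : R * R => - u) by apply: oppr_inj.
rewrite [RHS](reindex_inj opp_inj) /=; apply: eq_big => u.
  by rewrite !inE /= mulrNN.
by move=> _; rewrite -charN /dot /= !mulrN opprD.
Qed.

(** Each unit [k j] permutes the units, so a sum over units may be averaged over
    any family of multiplicative translates.  All cancellation below comes
    from a good choice of the family. *)
Lemma sum_unit_average (J : finType) (A : {set J}) (k : J -> R * R)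
    (g : R * R -> algC) :
  (forall j, j \in A -> k j \in unit_pairs) ->
  #|A|%:R * (\sum_(u in unit_pairs) g u) =
    \sum_(u in unit_pairs) \sum_(j in A) g (mulp (k j) u).
Proof.
move=> Hk; rewrite exchange_big /= mulr_natl -sumr_const.
by apply: eq_bigr => j Aj; rewrite (sum_unit_mulp g (Hk j Aj)).
Qed.

End Characters.

(** * Kloosterman's fourth moment bound over a finite integral domain *)

Section Domain.

Variables (R : finComPzRingType) (e : R -> algC).
Hypothesis eP : faithful_char e.
Hypothesis domain : forall x y : R, x * y = 0 -> x = 0 \/ y = 0.
Notation U := (unit_pairs R).

Lemma domain_mulIr (x y z : R) : z != 0 -> x * z = y * z -> x = y.
Proof.
move=> z0 H; have /domain[/eqP|zE] : (x - y) * z = 0 by rewrite mulrBl H subrr.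
  by rewrite subr_eq0 => /eqP.
by rewrite zE eqxx in z0.
Qed.

Lemma unit_pair_eq (u v : R * R) :
  u \in U -> v \in U -> u.1 = v.1 -> u = v.
Proof.
move=> /unit_pairsP Hu /unit_pairsP Hv; case: u v Hu Hv => [a b] [c d] /=.
move=> Hu Hv E; congr (_, _) => //; rewrite -E in Hv.
by rewrite -[b]mulr1 -Hv mulrCA mulrA Hu mul1r.
Qed.

Lemma mulp_free (c u v : R * R) : c != 0 -> u \in U -> v \in U ->
  mulp u c = mulp v c -> u = v.
Proof.
move=> c0 Hu Hv [H1 H2].
have [c1|c1] := eqVneq c.1 0; last first.
  by apply: unit_pair_eq => //; apply: (@domain_mulIr _ _ c.1); rewrite // mulrC H1 mulrC.
have c2 : c.2 != 0.
  by apply: contra c0 => /eqP c2; rewrite [c]surjective_pairing c1 c2.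
have E : u.2 = v.2 by apply: (@domain_mulIr _ _ c.2); rewrite // mulrC H2 mulrC.
apply: unit_pair_eq => //; move/unit_pairsP: Hu; move/unit_pairsP: Hv => Hv Hu.
by rewrite -[u.1]mulr1 -Hv [v.1 * _]mulrC mulrA -E Hu mul1r.
Qed.

(** A pair of units with nonzero sum is determined up to order by its sum and
    the sum of its inverses, because these determine its product: the sum of
    the inverses times the product is the sum. *)
Lemma unit_pair_sum_eq (a b c d : R * R) :
  a \in U -> b \in U -> c \in U -> d \in U -> a + b = c + d ->
  [\/ c = a /\ d = b, c = b /\ d = a | b = - a /\ d = - c].
Proof.
move=> Ha Hb Hc Hd; have opU (u : R * R) : u \in U -> - u \in U.
  by move=> /unit_pairsP Hu; apply/unit_pairsP; rewrite /= mulrNN.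
case: a b c d Ha Hb Hc Hd => [a a'] [b b'] [c c'] [d d'] Ha Hb Hc Hd [H1 H2].
move/unit_pairsP: (Ha) => /= Ea; move/unit_pairsP: (Hb) => /= Eb.
move/unit_pairsP: (Hc) => /= Ec; move/unit_pairsP: (Hd) => /= Ed.
(* The product of the pair, up to the factor a' + b', is the sum. *)
have Fab : (a' + b') * (a * b) = a + b.
  by transitivity ((a * a') * b + (b * b') * a); [ring | rewrite Ea Eb; ring].
have Fcd : (c' + d') * (c * d) = c + d.
  by transitivity ((c * c') * d + (d * d') * c); [ring | rewrite Ec Ed; ring].
have [t0|t0] := eqVneq (a' + b') 0.
  have s0 : a + b = 0 by rewrite -Fab t0 mul0r.
  constructor 3; split; apply: unit_pair_eq; rewrite ?opU //=.
    by apply/eqP; rewrite -addr_eq0 addrC s0.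
  by apply/eqP; rewrite -addr_eq0 addrC -H1 s0.
have Eab : a * b = c * d.
  by apply: (domain_mulIr t0); rewrite mulrC Fab mulrC H2 Fcd.
have /domain[/eqP|/eqP] : (c - a) * (c - b) = 0.
- transitivity (c * (c + d) - c * (a + b) + (a * b - c * d)); first by ring.
  by rewrite -H1 Eab !subrr addr0.
- rewrite subr_eq0 => /eqP ca; subst c; constructor 1; split.
    exact: unit_pair_eq.
  by apply: unit_pair_eq => //=; apply: (addrI a).
- rewrite subr_eq0 => /eqP cb; subst c; constructor 2; split.
    exact: unit_pair_eq.
  by apply: unit_pair_eq => //=; apply: (addrI b); rewrite -H1 addrC.
Qed.

(** One family of at most #|U|^2 quadruples for each of the three cases of
    [unit_pair_sum_eq]. *)
Lemma unit_pair_energy :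
  (#|[set t in setX (setX U U) (setX U U) |
        (t.1.1 + t.1.2 == t.2.1 + t.2.2)%R]| <= 3 * #|U| ^ 2)%N.
Proof.
(* One map for each way in which a quadruple can be degenerate. *)
pose f1 (t : (R * R) * (R * R)) := (t, t).
pose f2 (t : (R * R) * (R * R)) := (t, (t.2, t.1)).
pose f3 (t : (R * R) * (R * R)) := ((t.1, - t.1), (t.2, - t.2)).
set S := [set t in _ | _]; set V := setX U U.
have cV : #|V| = (#|U| ^ 2)%N by rewrite cardsX.
have sub : S \subset f1 @: V :|: f2 @: V :|: f3 @: V.
  apply/subsetP => -[[a b] [c d]]; rewrite in_set /=.
  move=> /andP[/setXP[/setXP[/= Ha Hb] /setXP[/= Hc Hd]] /eqP H]; rewrite !in_setU.
  have HV x y : x \in U -> y \in U -> (x, y) \in V by move=> *; apply/setXP.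
  case: (unit_pair_sum_eq Ha Hb Hc Hd H) => -[-> ->].
  - by rewrite (imset_f f1 (HV _ _ Ha Hb)).
  - by rewrite (imset_f f2 (HV _ _ Ha Hb)) orbT.
  - by rewrite (imset_f f3 (HV _ _ Ha Hc)) orbT.
apply: leq_trans (subset_leq_card sub) _; rewrite -cV.
rewrite -[3%N]/(1 + 1 + 1)%N !mulnDl !mul1n.
apply: leq_trans (leq_card_setU _ _).1 (leq_add _ (leq_imset_card _ _)).
by apply: leq_trans (leq_card_setU _ _).1 (leq_add _ _); apply: leq_imset_card.
Qed.

(** The sum at [c] is unchanged when [c] moves along the hyperbola of all
    [mulp u c], which has as many points as there are units.  So it occurs that
    many times in the fourth moment over all frequencies, which is an energy
    of the set of unit pairs. *)
Lemma kloo_fourth_moment (c : R * R) : c != 0 ->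
  `|kloosterman e c| ^+ 4 <= 3 * #|R|%:R ^+ 2 * #|U|%:R.
Proof.
move=> c0.
have U0 : (0 < #|U|)%N.
  by apply/card_gt0P; exists 1; apply/unit_pairsP; rewrite /= mulr1.
have sq xi : kloosterman e xi ^+ 2 = \sum_(t in setX U U) e (dot xi (t.1 + t.2)).
  rewrite expr2 /kloosterman big_distrlr /= pair_big /=.
  apply: eq_big => [[u v]|t _]; first by rewrite in_setX.
  by rewrite dotDr [RHS](charD eP).
have E := energy_identity eP (setX U U) (fun t => t.1 + t.2).
have M : \sum_xi `|kloosterman e xi| ^+ 4 <= #|R|%:R ^+ 2 * (3 * #|U|%:R ^+ 2).
  under eq_bigr => xi _ do rewrite -[4%N]/(2 * 2)%N exprM -normrX sq.
  rewrite E -natrX -(natrX _ #|U|) -!natrM ler_nat leq_mul2l.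
  by rewrite unit_pair_energy orbT.
have L : #|U|%:R * `|kloosterman e c| ^+ 4 <= \sum_xi `|kloosterman e xi| ^+ 4.
  have -> : #|U|%:R * `|kloosterman e c| ^+ 4 = \sum_(u in U) `|kloosterman e (mulp u c)| ^+ 4.
    rewrite mulr_natl -sumr_const; apply: eq_bigr => u Hu.
    by rewrite kloo_mulp.
  have inj : {in U &, injective (fun u => mulp u c)}.
    by move=> u v Hu Hv; apply: mulp_free.
  rewrite -(big_imset (fun xi => `|kloosterman e xi| ^+ 4) inj) /=.
  rewrite [leRHS](bigID (mem ((fun u => mulp u c) @: U))) /= lerDl.
  by apply: sumr_ge0 => xi _; rewrite exprn_ge0.
rewrite -(ler_pM2l (_ : 0 < #|U|%:R)) ?ltr0n //.
by apply: le_trans L (le_trans M _); rewrite le_eqVlt; apply/orP; left; apply/eqP; ring.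
Qed.

(** On unit pairs the equation reads c.1 * u.1 ^ 2 = c.2. *)
Lemma card_unit_ratio (c : R * R) : c != 0 ->
  (#|[set u in U | (c.1 * u.1 == c.2 * u.2)%R]| <= 2)%N.
Proof.
move=> c0; set S := [set u in U | _].
have [->|[w]] := set_0Vmem S; first by rewrite cards0.
rewrite in_set => /andP[Uw /eqP Hw].
have sub : S \subset [set w; - w].
  apply/subsetP => v; rewrite in_set => /andP[Uv /eqP Hv].
  have sqE (u : R * R) : u \in U -> c.1 * u.1 = c.2 * u.2 -> c.1 * (u.1 * u.1) = c.2.
    by move=> /unit_pairsP Hu E; rewrite mulrA E -mulrA [u.2 * _]mulrC Hu mulr1.
  have c1 : c.1 != 0.
    apply: contra c0 => /eqP c1; have := sqE _ Uw Hw; rewrite c1 mul0r => c2.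
    by rewrite [c]surjective_pairing c1 -c2.
  have /domain[/eqP|/domain[]/eqP] : c.1 * ((v.1 - w.1) * (v.1 + w.1)) = 0.
  - transitivity (c.1 * (v.1 * v.1) - c.1 * (w.1 * w.1)); first by ring.
    by rewrite !sqE // subrr.
  - by rewrite (negPf c1).
  - by rewrite subr_eq0 => /eqP E; rewrite !inE (unit_pair_eq Uv Uw E) eqxx.
  - rewrite addr_eq0 => /eqP E; rewrite !inE; apply/orP; right; apply/eqP.
    apply: unit_pair_eq => //.
    by apply/unit_pairsP; rewrite /= mulrNN; apply/unit_pairsP.
by apply: leq_trans (subset_leq_card sub) _; rewrite cards2; case: (_ != _).
Qed.

End Domain.

(** * Stationary phase *)

Section Stationary.

Lemma sum_expr_unity (p : nat) (x : algC) : x ^+ p = 1 ->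
  \sum_(z < p) x ^+ z = (if x == 1 then p%:R else 0).
Proof.
move=> xp; case: eqP => [->|/eqP x1].
  under eq_bigr => z _ do rewrite expr1n.
  by rewrite sumr_const card_ord.
have /eqP := subrX1 x p; rewrite xp subrr eq_sym mulf_eq0 subr_eq0.
by rewrite (negPf x1) => /eqP.
Qed.

Variables (R : finComPzRingType) (e : R -> algC).
Hypothesis eP : faithful_char e.
Notation U := (unit_pairs R).

(** Average over the units 1 + z T for z < p.  Since T^2 kills [c.2], the inverse
    of 1 + z T acts on [c.2] as 1 - z T, so the phase is affine in z with slope
    T c.1 u.1 - T c.2 u.2, an element killed by p; the average over z is
    therefore the indicator of the vanishing of the slope. *)
Lemma kloo_stationary (p : nat) (T : R) (c : R * R) : (0 < p)%N ->
  (forall z : nat, exists w, (1 + z%:R * T) * w == 1) ->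
  p%:R * (T * c.1) = 0 -> p%:R * (T * c.2) = 0 -> T * (T * c.2) = 0 ->
  kloosterman e c = \sum_(u in U | T * c.1 * u.1 == T * c.2 * u.2) e (dot c u).
Proof.
move=> p0 HT pc1 pc2 Tc2.
pose k (z : 'I_p) : R * R := (1 + z%:R * T, xchoose (HT z)).
have Hk z : z \in [set: 'I_p] -> k z \in U.
  by move=> _; apply/unit_pairsP/eqP; apply: (xchooseP (HT z)).
have dotk z u : dot c (mulp (k z) u) =
    dot c u + z%:R * (T * c.1 * u.1 - T * c.2 * u.2).
  have /unit_pairsP kz := Hk z (in_setT _); move: kz.
  rewrite /dot /mulp /=; set k2 := xchoose _ => kz.
  have E : c.2 * k2 = c.2 * (1 - z%:R * T).
    transitivity (c.2 * (1 - z%:R * T) * ((1 + z%:R * T) * k2)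
                  + (z%:R * z%:R) * (T * (T * c.2)) * k2); first by ring.
    by rewrite kz Tc2 mulr1 mulr0 mul0r addr0.
  transitivity (c.1 * u.1 * (1 + z%:R * T) + c.2 * k2 * u.2); first by ring.
  by rewrite E; ring.
have := sum_unit_average (fun u => e (dot c u)) Hk.
rewrite -/(kloosterman e c) cardsT card_ord.
under eq_bigr => u _.
  under eq_bigr => z _ do rewrite dotk (charD eP) (charMn eP).
  rewrite -big_distrr /=.
  rewrite (eq_bigl xpredT) => [|z]; last by rewrite in_setT.
  rewrite sum_expr_unity; last first.
    rewrite -(charMn eP) mulrBr.
    rewrite (_ : p%:R * _ = p%:R * (T * c.1) * u.1); last by ring.
    rewrite pc1 mul0r (_ : p%:R * _ = p%:R * (T * c.2) * u.2); last by ring.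
    by rewrite pc2 mul0r subrr (char0 eP).
  rewrite (_ : e _ * (if _ then _ else _) = p%:R *
     (if T * c.1 * u.1 == T * c.2 * u.2 then e (dot c u) else 0)); last first.
    rewrite (_ : (e _ == 1) = (T * c.1 * u.1 == T * c.2 * u.2)).
      by case: eqP => _; rewrite ?mulr0 // mulrC.
    by rewrite -[RHS]subr_eq0; apply/eqP/eqP => [/(char_faithful eP)|->] //; rewrite (char0 eP).
  over.
rewrite -big_distrr -big_mkcondr /= => /(mulfI _) -> //.
by rewrite pnatr_eq0 -lt0n.
Qed.

(** A unit u with T c.1 u.1 = T c.2 u.2 would make the two elements vanish
    together, so there is no stationary point. *)
Lemma kloo_vanish (p : nat) (T : R) (c : R * R) : (0 < p)%N ->
  (forall z : nat, exists w, (1 + z%:R * T) * w == 1) ->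
  p%:R * (T * c.1) = 0 -> p%:R * (T * c.2) = 0 -> T * (T * c.2) = 0 ->
  (T * c.1 == 0) != (T * c.2 == 0) -> kloosterman e c = 0.
Proof.
move=> p0 HT pc1 pc2 Tc2 neq.
rewrite (kloo_stationary p0 HT) //; apply: big1 => u /andP[/unit_pairsP Uu /eqP E].
case/negP: neq; apply/eqP; apply/eqP/eqP => H.
  by rewrite -[T * c.2]mulr1 -Uu [u.1 * _]mulrC mulrA -E H !mul0r.
by rewrite -[T * c.1]mulr1 -Uu mulrA E H !mul0r.
Qed.

Lemma kloo_le_stationary (p : nat) (T : R) (c : R * R) : (0 < p)%N ->
  (forall z : nat, exists w, (1 + z%:R * T) * w == 1) ->
  p%:R * (T * c.1) = 0 -> p%:R * (T * c.2) = 0 -> T * (T * c.2) = 0 ->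
  `|kloosterman e c| <= #|[set u in U | T * c.1 * u.1 == T * c.2 * u.2]|%:R.
Proof.
move=> p0 HT pc1 pc2 Tc2; rewrite (kloo_stationary p0 HT) //.
apply: le_trans (ler_norm_sum _ _ _) _.
under eq_bigr => u _ do rewrite (char_norm eP).
rewrite sumr_const (eq_card (B := [set u in U | T * c.1 * u.1 == T * c.2 * u.2])) //.
by move=> u; rewrite in_set.
Qed.
End Stationary.

(** * Residues modulo N and their additive characters *)

Section Residues.

Variable (N : nat).
Hypothesis N_gt0 : (0 < N)%N.

Lemma Zmod_natE (n : nat) : (n%:R : Zmod N) = inZp n.
Proof.
apply: val_inj; rewrite /= Zp_mulrn /=.
by rewrite modnMml mul1n.
Qed.

Lemma Zmod_valK (x : Zmod N) : (nat_of_ord x)%:R = x.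
Proof. by rewrite Zmod_natE valZpK. Qed.

Lemma Zmod_nat_eq0 (n : nat) : ((n%:R : Zmod N) == 0) = (N %| n)%N.
Proof. by rewrite Zmod_natE -val_eqE /= prednK. Qed.

Lemma Zmod_nat_eq (m n : nat) :
  ((m%:R : Zmod N) == n%:R) = (m == n %[mod N])%N.
Proof. by rewrite !Zmod_natE -val_eqE /= prednK. Qed.

Definition zchar (w : algC) (x : Zmod N) : algC := w ^+ (nat_of_ord x).

Lemma zchar_nat w n : w ^+ N = 1 -> zchar w n%:R = w ^+ n.
Proof.
by move=> wN; rewrite /zchar Zmod_natE /= prednK // expr_mod.
Qed.

Lemma zchar_faithful w : N.-primitive_root w -> faithful_char (zchar w).
Proof.
move=> wP; have wN := prim_expr_order wP; split.
- move=> x y; rewrite -[x]Zmod_valK -[y]Zmod_valK -natrD !zchar_nat //.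
  by rewrite exprD.
- move=> x; rewrite /zchar normrX.
  have -> : `|w| = 1; last by rewrite expr1n.
  apply/eqP; rewrite -(@pexpr_eq1 _ _ N) ?normr_ge0 //.
  by rewrite -normrX wN normr1.
- move=> x /eqP; rewrite /zchar -(prim_order_dvd wP) -Zmod_nat_eq0.
  by rewrite Zmod_valK => /eqP.
Qed.

Lemma Zmod_unit (a : nat) : coprime N a -> exists b : Zmod N, a%:R * b == 1.
Proof.
move=> cop; have a0 := N_gt0.
have [E|Npos] := posnP a.
  exists 0; rewrite mulr0; move: cop; rewrite E /coprime gcdn0 => /eqP N1.
  by rewrite eq_sym -[1]/(1%:R) Zmod_nat_eq0 N1.
case: (egcdnP N Npos) => u v E _; exists u%:R.
rewrite -natrM mulnC E -[1]/(1%:R) Zmod_nat_eq.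
by move: cop; rewrite coprime_sym /coprime => /eqP ->; rewrite modnMDl.
Qed.

End Residues.

(** * Orders of residues at a prime *)

Section PrimeModulus.
Variable (p : nat).
Hypothesis p_pr : prime p.

Lemma Zmod_prime_domain (x y : Zmod p) : x * y = 0 -> x = 0 \/ y = 0.
Proof.
have p0 := prime_gt0 p_pr; move/eqP.
rewrite -[x]Zmod_valK -[y]Zmod_valK -natrM Zmod_nat_eq0 //.
by rewrite Euclid_dvdM // -!Zmod_nat_eq0 // => /orP[]/eqP; [left|right].
Qed.

Lemma card_unit_pairs_prime : (p.-1 <= #|unit_pairs (Zmod p)|)%N.
Proof.
have p0 := prime_gt0 p_pr.
apply: leq_trans (leq_imset_card fst _).
rewrite -[p in (p.-1 <= _)%N](card_Zmod p0) -(cardsC1 (0 : Zmod p)).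
apply/subset_leq_card/subsetP => x; rewrite !inE => x0.
have [|y xy] := @Zmod_unit p p0 (nat_of_ord x).
  by rewrite prime_coprime // -Zmod_nat_eq0 // Zmod_valK.
apply/imsetP; exists (x, y) => //; rewrite inE /=.
by rewrite Zmod_valK in xy.
Qed.
End PrimeModulus.

Section PrimeExponent.
Variables (N p : nat).
Hypotheses (N_gt0 : (0 < N)%N) (p_pr : prime p).
Notation M := (N`_p^')%N.

Lemma cofactorE : (M * p ^ logn p N = N)%N.
Proof. by rewrite -p_part mulnC partnC. Qed.

Lemma order_exp_exists (c : Zmod N) : exists j, (M * p ^ j)%:R * c == 0.
Proof.
exists (logn p N); rewrite cofactorE.
have /eqP -> : (N%:R : Zmod N) == 0 by rewrite Zmod_nat_eq0.
by rewrite mul0r.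
Qed.

(** The exponent of p in the additive order of [c]: the factor M = N`_p^' kills
    every other prime component. *)
Definition order_exp (c : Zmod N) : nat := ex_minn (order_exp_exists c).

Lemma order_exp_le (c : Zmod N) j : (order_exp c <= j)%N = ((M * p ^ j)%:R * c == 0).
Proof.
rewrite /order_exp; case: ex_minnP => m /eqP Hm minm.
apply/idP/idP => [mj|]; last exact: minm.
rewrite -(subnK mj) expnD mulnCA natrM -mulrA Hm mulr0.
by rewrite eqxx.
Qed.

Lemma order_exp_nat j n : (order_exp (n%:R) <= j)%N = (p ^ logn p N %| p ^ j * n)%N.
Proof.
rewrite order_exp_le -natrM Zmod_nat_eq0 // -[X in (X %| _)%N]cofactorE -mulnA.
by rewrite dvdn_pmul2l // part_gt0.
Qed.

(** Each factor [Q] cancels as many factors p from the order as it contains. *)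
Lemma order_exp_mulX (c : Zmod N) Q i : (0 < Q)%N ->
  order_exp (c * Q%:R ^+ i) = (order_exp c - i * logn p Q)%N.
Proof.
move=> Q0.
suff H j : (order_exp (c * Q%:R ^+ i)%R <= j)%N = (order_exp c - i * logn p Q <= j)%N.
  by apply/eqP; rewrite eqn_leq -H leqnn H leqnn.
rewrite leq_subLR -{1}[c]Zmod_valK -{2}[c]Zmod_valK // -natrX -natrM !order_exp_nat.
have Qi0 : (0 < Q ^ i)%N by rewrite expn_gt0 Q0.
rewrite -{1}(partnC p Qi0) p_part lognX.
set q := (_ * logn p Q)%N; set Q' := ((Q ^ i)`_p^')%N.
rewrite (_ : p ^ j * (c * (p ^ q * Q')) = p ^ (q + j) * c * Q')%N; last first.
  by rewrite expnD; lia.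
rewrite Gauss_dvdl // coprimeXl // coprime_sym.
by apply: (@p'nat_coprime p); rewrite ?part_pnat ?pnat_id.
Qed.

Lemma order_exp_gt0_dvd (c : Zmod N) : (0 < order_exp c)%N -> (p %| N)%N.
Proof.
apply: contraLR => pN; rewrite -leqNgt order_exp_le expn0 muln1.
have /eqP -> : ((M)%:R : Zmod N) == 0; last by rewrite mul0r.
rewrite Zmod_nat_eq0 // -{1}cofactorE lognE p_pr N_gt0 (negPf pN).
by rewrite expn0 muln1.
Qed.

End PrimeExponent.

(** * Torsion at a prime and the corresponding component of the unit group *)

Section PrimeComponent.
Variables (N p : nat).
Hypotheses (N_gt0 : (0 < N)%N) (p_pr : prime p).
Notation M := (N`_p^')%N.

(** Every prime factor of N divides M p^j, so 1 + z M p^j is prime to N. *)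
Lemma unipotent_unit j z : (0 < j)%N ->
  exists w : Zmod N, (1 + z%:R * (M * p ^ j)%:R) * w == 1.
Proof.
move=> j0; have -> : 1 + z%:R * (M * p ^ j)%:R = (1 + z * (M * p ^ j))%N%:R :> Zmod N.
  by rewrite natrD [(z * _)%:R]natrM.
apply: Zmod_unit => //.
have cop : coprime (M * p ^ j) (1 + z * (M * p ^ j)).
  by rewrite /coprime [(1 + _)%N]addnC gcdnMDl gcdn1.
apply: (@coprime_dvdl _ ((M * p ^ j) ^ (logn p N).+1)); last first.
  by rewrite coprimeXl.
rewrite -{1}(cofactorE p N_gt0) expnMn -expnM dvdn_mul //.
  by rewrite expnS dvdn_mulr.
by apply: dvdn_exp2l; nia.
Qed.

Notation order_exp := (order_exp p N_gt0).

Definition max_order_exp (c : Zmod N * Zmod N) := maxn (order_exp c.1) (order_exp c.2).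

(** The choice of T for [kloo_stationary]: T c has order dividing p in both
    coordinates because M p^t kills [c], where t is the maximal exponent, and
    T^2 kills [c.2] because p divides T as soon as t >= 2. *)
Lemma stationary_setup (c : Zmod N * Zmod N) (T : Zmod N) :
  T = (M * p ^ (max_order_exp c).-1)%:R -> (1 < max_order_exp c)%N ->
  [/\ forall z : nat, exists w0 : Zmod N, (1 + z%:R * T) * w0 == 1,
      p%:R * (T * c.1) = 0, p%:R * (T * c.2) = 0 & T * (T * c.2) = 0].
Proof.
move=> TE c2; have p0 := prime_gt0 p_pr.
have pT x : (order_exp x <= max_order_exp c)%N -> p%:R * (T * x) = 0.
  rewrite order_exp_le TE => /eqP H; rewrite mulrA -natrM mulnCA -expnS.
  by rewrite prednK // ltnW.
have pT2 : p%:R * (T * c.2) = 0 by rewrite pT // leq_maxr.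
split=> //.
- by move=> z; rewrite TE; apply: unipotent_unit; lia.
- by rewrite pT // leq_maxl.
have TE2 : T = (M * p ^ (max_order_exp c).-2)%:R * p%:R.
  by rewrite TE -natrM -mulnA -expnSr prednK //; lia.
by rewrite {1}TE2 -mulrA pT2 mulr0.
Qed.

Lemma kloo_vanish_exp (w : algC) (c : Zmod N * Zmod N) :
  N.-primitive_root w ->
  (1 < max_order_exp c)%N -> order_exp c.1 != order_exp c.2 -> kloosterman (zchar w) c = 0.
Proof.
move=> wP c2 neq; have [HT p1 p2 TT] := stationary_setup (erefl _) c2.
apply: (kloo_vanish (zchar_faithful N_gt0 wP) (prime_gt0 p_pr) HT) => //.
rewrite -!order_exp_le; move: c2 neq; rewrite /max_order_exp.
move: (order_exp c.1) (order_exp c.2) => a b ab neq.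
by case: (leqP a _); case: (leqP b _) => //; lia.
Qed.

Hypothesis pN : (p %| N)%N.

(** The isomorphism of Z/p with the p-torsion of Z/N. *)
Definition torsion_embed (a : Zmod p) : Zmod N := (N %/ p * nat_of_ord a)%:R.

Lemma torsion_embed_nat n : torsion_embed n%:R = (N %/ p * n)%:R.
Proof.
have p0 := prime_gt0 p_pr; apply/eqP; rewrite /torsion_embed Zmod_nat_eq //.
rewrite Zmod_natE /= prednK //.
by rewrite -{2 4}(divnK pN) -!muln_modr modn_mod.
Qed.

Lemma torsion_embed_inj : injective torsion_embed.
Proof.
have p0 := prime_gt0 p_pr.
move=> a b /eqP; rewrite /torsion_embed Zmod_nat_eq // -{2 4}(divnK pN) -!muln_modr.
have Np0 : (0 < N %/ p)%N by rewrite divn_gt0 // dvdn_leq.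
move=> H; apply/eqP; rewrite -[a]Zmod_valK -[b]Zmod_valK Zmod_nat_eq //.
by rewrite -(eqn_pmul2l Np0).
Qed.

Lemma torsion_embedD a b : torsion_embed (a + b) = torsion_embed a + torsion_embed b.
Proof.
by rewrite -[a]Zmod_valK -[b]Zmod_valK -natrD !torsion_embed_nat mulnDr natrD.
Qed.

Lemma torsion_embedM a (b : Zmod p) : torsion_embed (a * b) = torsion_embed a * (nat_of_ord b)%:R.
Proof.
by rewrite -{1}[a]Zmod_valK -{1}[b]Zmod_valK -natrM !torsion_embed_nat mulnA natrM.
Qed.

Lemma torsion_embed0 : torsion_embed 0 = 0.
Proof. by rewrite -[0]/(0%:R) torsion_embed_nat muln0. Qed.

Lemma p_torsionP (x : Zmod N) : p%:R * x = 0 -> exists a, x = torsion_embed a.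
Proof.
have p0 := prime_gt0 p_pr.
move/eqP; rewrite -{1}[x]Zmod_valK -natrM Zmod_nat_eq0 //.
rewrite -{1}(divnK pN) mulnC dvdn_pmul2l // => /dvdnP[m E].
by exists m%:R; rewrite torsion_embed_nat mulnC -E Zmod_valK.
Qed.

(** The idempotent of Z/N that projects onto the p-primary component. *)
Lemma torsion_projector : exists eps : nat,
  [/\ (M %| eps)%N & eps = 1 %[mod p ^ logn p N]].
Proof.
have cop : coprime M (p ^ logn p N).
  apply: coprimeXr; rewrite coprime_sym.
  by apply: (@pnat_coprime p); rewrite ?part_pnat ?pnat_id.
exists (chinese M (p ^ logn p N) 0 1); split.
  by rewrite /dvdn chinese_modl // mod0n.
by rewrite chinese_modr.
Qed.

(** Units modulo p lift to units modulo N that are 1 outside the p-component.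
    The lift of v is 1 + eps (v - 1) with the idempotent eps of
    [torsion_projector]; on elements x with eps x of order dividing p, it only
    depends on v modulo p and multiplies eps x by v while fixing x - eps x. *)
Lemma unit_lift : exists (eps : Zmod N) (k : Zmod p * Zmod p -> Zmod N * Zmod N),
  [/\ forall v, v \in unit_pairs (Zmod p) -> k v \in unit_pairs (Zmod N),
      forall v, v \in unit_pairs (Zmod p) -> forall x, p%:R * (eps * x) = 0 ->
         x * (k v).1 = x - eps * x + eps * x * (nat_of_ord v.1)%:R /\
         x * (k v).2 = x - eps * x + eps * x * (nat_of_ord v.2)%:R,
      forall x, p%:R * x = 0 -> eps * x = x,
      forall x, M%:R * (eps * x) = M%:R * x &
      forall x, (M * p)%:R * x = 0 -> p%:R * (eps * x) = 0].
Proof.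
have p0 := prime_gt0 p_pr.
have k0 : (0 < logn p N)%N by rewrite logn_gt0 mem_primes p_pr N_gt0.
have pk0 : (0 < p ^ logn p N)%N by rewrite expn_gt0 p0.
have ppk : (p %| p ^ logn p N)%N by rewrite dvdn_exp.
have [eps [Me e1]] := torsion_projector.
have annih n : (p ^ logn p N %| n)%N -> eps%:R * n%:R = 0 :> Zmod N.
  move=> Hn; apply/eqP; rewrite -natrM Zmod_nat_eq0 //.
  by rewrite -(cofactorE p N_gt0) dvdn_mul.
have congr_eps m n : m = n %[mod p ^ logn p N] -> eps%:R * m%:R = eps%:R * n%:R :> Zmod N.
  move=> E; wlog mn : m n E / (m <= n)%N.
    by move=> H; case/orP: (leq_total m n) => ?; [|symmetry]; apply: H.
  rewrite -(subnKC mn) natrD mulrDr [X in _ + X]annih ?addr0 //.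
  by rewrite -eqn_mod_dvd // eq_sym; apply/eqP.
have congr_p x m n : p%:R * x = 0 -> m = n %[mod p] -> x * m%:R = x * n%:R :> Zmod N.
  move=> px E; have red k : x * k%:R = x * (k %% p)%:R.
    transitivity ((k %/ p)%:R * (p%:R * x) + x * (k %% p)%:R).
      by rewrite {1}(divn_eq k p) natrD natrM; ring.
    by rewrite px mulr0 add0r.
  by rewrite red E -red.
have lift v : exists k : Zmod N * Zmod N, v \in unit_pairs (Zmod p) ->
    k \in unit_pairs (Zmod N) /\
    (forall x, p%:R * (eps%:R * x) = 0 ->
         x * k.1 = x - eps%:R * x + eps%:R * x * (nat_of_ord v.1)%:R /\
         x * k.2 = x - eps%:R * x + eps%:R * x * (nat_of_ord v.2)%:R).
  have [/unit_pairsP Uv|] := boolP (v \in unit_pairs (Zmod p)); last by exists 0.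
  have vv : v.1 * v.2 = 1 %[mod p].
    by apply/eqP; rewrite -Zmod_nat_eq // natrM !Zmod_valK Uv.
  have cop : coprime (p ^ logn p N) v.1.
    rewrite coprimeXl // prime_coprime //; apply/negP => pv.
    move: vv; rewrite -modnMml (eqP pv) mul0n mod0n modn_small ?prime_gt1 //.
  have [b /eqP vb] := Zmod_unit pk0 cop.
  have vs : (v.1 * b = 1 %[mod p ^ logn p N])%N.
    by apply/eqP; rewrite -Zmod_nat_eq // natrM Zmod_valK vb.
  have bv : (b = v.2 %[mod p])%N.
    have /eqP vb1 : (nat_of_ord v.1 * b)%:R == 1%:R :> Zmod p.
      by rewrite Zmod_nat_eq // -(modn_dvdm _ ppk) vs modn_dvdm.
    rewrite natrM Zmod_valK in vb1.
    apply/eqP; rewrite -Zmod_nat_eq // Zmod_valK; apply/eqP.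
    transitivity (v.1 * b%:R * v.2); last by rewrite vb1 mul1r.
    by rewrite mulrAC Uv mul1r.
  exists (1 + eps%:R * ((nat_of_ord v.1)%:R - 1), 1 + eps%:R * (b%:R - 1)) => _.
  split=> [|x px]; last first.
    by split=> /=; [|rewrite -(congr_p _ _ _ px bv)]; ring.
  apply/unit_pairsP => /=.
  have ee : eps%:R * eps%:R = eps%:R :> Zmod N by rewrite (congr_eps _ _ e1) mulr1.
  have evb : eps%:R * ((nat_of_ord v.1)%:R * b%:R) = eps%:R :> Zmod N.
    by rewrite -natrM (congr_eps _ _ vs) mulr1.
  transitivity (1 + (eps%:R * eps%:R - eps%:R) * ((nat_of_ord v.1)%:R - 1) * (b%:R - 1)
     + (eps%:R * ((nat_of_ord v.1)%:R * b%:R) - eps%:R) : Zmod N); first by ring.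
  by rewrite ee evb !subrr !mul0r !addr0.
have [k Hk] := fin_all_exists lift.
exists eps%:R, k; split.
- by move=> v /Hk[].
- by move=> v /Hk[].
- move=> x px; rewrite mulrC (congr_p _ _ _ px (_ : eps = 1 %[mod p])) ?mulr1 //.
  by rewrite -(modn_dvdm _ ppk) e1 modn_dvdm.
- move=> x; rewrite mulrA -natrM; congr (_ * _); apply/eqP.
  have scale m q : eps = 1 %[mod q] -> (m * eps = m %[mod m * q])%N.
    by move=> E; rewrite -{3}[m]muln1 -!muln_modr E.
  by rewrite Zmod_nat_eq //; have := scale M _ e1; rewrite cofactorE // => ->.
- move=> x Mx; case/dvdnP: Me => m ->; rewrite natrM.
  transitivity (m%:R * ((M * p)%:R * x)); last by rewrite Mx mulr0.
  by rewrite natrM; ring.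
Qed.

Variable (w : algC).
Hypothesis wP : N.-primitive_root w.
Notation e := (zchar w).
Notation eP := (zchar_faithful N_gt0 wP).

Lemma zchar_torsion_embed a : e (torsion_embed a) = zchar (w ^+ (N %/ p)) a.
Proof.
by rewrite /torsion_embed zchar_nat ?(prim_expr_order wP) // exprM.
Qed.

Lemma prim_root_torsion : p.-primitive_root (w ^+ (N %/ p)).
Proof.
have p0 := prime_gt0 p_pr.
have := exp_prim_root wP (N %/ p).
have -> : gcdn (N %/ p) N = (N %/ p)%N by apply/gcdn_idPl; rewrite -{2}(divnK pN) dvdn_mulr.
rewrite (_ : N %/ (N %/ p) = p)%N //.
by rewrite -{1}(divnK pN) mulKn // divn_gt0 // dvdn_leq.
Qed.

End PrimeComponent.

(** * Kloosterman sums with a large prime in the order of the frequency *)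

Section LargePrime.

Lemma card_unit_pairs_gt0 (R : finComPzRingType) : (0 < #|unit_pairs R|)%N.
Proof. by apply/card_gt0P; exists 1; apply/unit_pairsP; rewrite /= mulr1. Qed.

(** With m >= p - 1 units, [kloo_fourth_moment] bounds the fourth power of the
    sum by 3 p^2 m <= 12 m^3, which is at most (m / n)^4 when
    12 n^4 <= m. *)
Lemma prime_kloo_bound (n p : nat) (z : algC) (a : Zmod p * Zmod p) :
  prime p -> (12 * n ^ 4 <= p.-1)%N -> p.-primitive_root z -> a != 0 ->
  n%:R * `|kloosterman (zchar z) a| <= #|unit_pairs (Zmod p)|%:R.
Proof.
move=> p_pr np zP a0; have p0 := prime_gt0 p_pr.
have dom := @Zmod_prime_domain p p_pr.
have := kloo_fourth_moment (zchar_faithful p0 zP) dom a0.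
rewrite card_Zmod // => H.
have Up := card_unit_pairs_prime p_pr; set m := #|_| in H Up *.
rewrite -(@ler_pXn2r _ 4) ?nnegrE ?mulr_ge0 ?ler0n ?normr_ge0 // exprMn.
apply: le_trans (ler_wpM2l (exprn_ge0 4 (ler0n _ n)) H) _.
rewrite -!natrX -!natrM ler_nat.
have p2 : (p <= 2 * m)%N by have := prime_gt1 p_pr; lia.
have pp : (p ^ 2 <= 4 * m ^ 2)%N.
  by rewrite -[4%N]/(2 ^ 2)%N -expnMn leq_exp2r.
have nm := leq_trans np Up.
apply: (@leq_trans (n ^ 4 * (3 * (4 * m ^ 2) * m))).
  by rewrite leq_mul2l leq_mul2r leq_mul2l pp !orbT.
rewrite (_ : n ^ 4 * _ = (12 * n ^ 4) * m ^ 3)%N; last by rewrite [(m ^ 3)%N]expnS; ring.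
by rewrite [(m ^ 4)%N]expnS leq_mul2r nm orbT.
Qed.

Variables (N p : nat).
Hypotheses (N_gt0 : (0 < N)%N) (p_pr : prime p).
Variable (w : algC).
Hypothesis wP : N.-primitive_root w.
Hypothesis pN : (p %| N)%N.
Notation M := (N`_p^')%N.
Notation e := (zchar w).
Notation eP := (zchar_faithful N_gt0 wP).
Notation max_order_exp := (max_order_exp p N_gt0).
Notation U := (unit_pairs (Zmod N)).
Notation Up := (unit_pairs (Zmod p)).
Notation order_exp := (order_exp p N_gt0).
Notation torsion_embed := (@torsion_embed N p).

(** By [kloo_le_stationary] it is enough to count the stationary points.  They
    are cut out by T c.1 u.1 = T c.2 u.2 in the p-torsion, that is, by a
    condition on u modulo p.  Averaging over the lifts of the units modulo p
    reduces the count to [card_unit_ratio], at most 2 for each u. *)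
Lemma kloo_deep_bound (c : Zmod N * Zmod N) : (1 < max_order_exp c)%N ->
  #|Up|%:R * `|kloosterman e c| <= 2 * #|U|%:R.
Proof.
move=> c2; have [HT p1 p2 TT] := stationary_setup p_pr (erefl _) c2.
set T := (_%:R : Zmod N) in HT p1 p2 TT.
have [eps [k [kU keps epsid _ _]]] := unit_lift N_gt0 p_pr pN.
have kp v x : v \in Up -> p%:R * x = 0 ->
   x * (k v).1 = x * (nat_of_ord v.1)%:R /\ x * (k v).2 = x * (nat_of_ord v.2)%:R.
  move=> Uv px; have pe : p%:R * (eps * x) = 0 by rewrite epsid.
  by have [-> ->] := keps v Uv x pe; rewrite epsid // subrr !add0r.
apply: le_trans (ler_wpM2l (ler0n _ _) (kloo_le_stationary eP (prime_gt0 p_pr) HT p1 p2 TT)) _.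
pose g (u : Zmod N * Zmod N) : algC := (T * c.1 * u.1 == T * c.2 * u.2)%:R.
have -> : #|[set u in U | T * c.1 * u.1 == T * c.2 * u.2]|%:R = \sum_(u in U) g u.
  rewrite -sum1_card natr_sum big_mkcond [RHS]big_mkcond /=.
  by apply: eq_bigr => u _; rewrite in_set /g; case: (u \in U); case: (_ == _).
rewrite (sum_unit_average g kU) mulr_natr -sumr_const.
apply: ler_sum => u /unit_pairsP Uu.
have [a Ea] : exists a, T * c.1 * u.1 = torsion_embed a.
  by apply: (p_torsionP N_gt0 p_pr pN); rewrite mulrA p1 mul0r.
have [b Eb] : exists b, T * c.2 * u.2 = torsion_embed b.
  by apply: (p_torsionP N_gt0 p_pr pN); rewrite mulrA p2 mul0r.
have ab0 : (a, b) != 0.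
  apply/eqP => -[a0 b0].
  have t0 : torsion_embed 0 = 0 by exact: torsion_embed0.
  have T1 : T * c.1 = 0 by rewrite -[LHS]mulr1 -Uu mulrA Ea a0 t0 mul0r.
  have T2 : T * c.2 = 0.
    by rewrite -[LHS]mulr1 -Uu [u.1 * _]mulrC mulrA Eb b0 t0 mul0r.
  move/eqP: T1; move/eqP: T2; rewrite -!order_exp_le.
  by move: c2; rewrite /max_order_exp; lia.
rewrite (eq_bigr (fun v : Zmod p * Zmod p => (a * v.1 == b * v.2)%:R : algC)); last first.
  move=> v Uv; rewrite /g /mulp /=; congr (_ %:R); congr (nat_of_bool _).
  have pt x : p%:R * (T * x) = 0 -> p%:R * (T * x * u.1) = 0 /\ p%:R * (T * x * u.2) = 0.
    by move=> H; rewrite !mulrA -[p%:R * _ * _]mulrA H !mul0r.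
  have [E1 _] := kp v _ Uv (pt _ p1).1; have [_ E2] := kp v _ Uv (pt _ p2).2.
  rewrite [T * c.1 * _]mulrA E1 [T * c.2 * _]mulrA E2 Ea Eb.
  rewrite -!(torsion_embedM N_gt0 p_pr pN) //.
  by apply/eqP/eqP => [/(torsion_embed_inj N_gt0 p_pr pN)|->].
have := card_unit_ratio (@Zmod_prime_domain p p_pr) ab0.
rewrite -(ler_nat algC); apply: le_trans.
rewrite -sum1_card natr_sum big_mkcond [leRHS]big_mkcond /=.
apply: ler_sum => v _; rewrite !in_set /=.
by case: (v.1 * v.2 == 1); case: (_ == _).
Qed.

(** Averaging over the lifts of the units modulo p leaves, up to a factor of
    absolute value 1, a Kloosterman sum modulo p. *)
Lemma kloo_shallow_bound (n : nat) (c : Zmod N * Zmod N) : (12 * n ^ 4 <= p.-1)%N ->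
  max_order_exp c = 1%N -> n%:R * `|kloosterman e c| <= #|U|%:R.
Proof.
move=> np c1; have [eps [k [kU keps _ Meps peps]]] := unit_lift N_gt0 p_pr pN.
have Up0 : 0 < #|Up|%:R :> algC by rewrite ltr0n card_unit_pairs_gt0.
rewrite -(ler_pM2l Up0) mulrCA -[#|Up|%:R in leLHS]normr_nat -normrM.
rewrite [#|Up|%:R * kloosterman e c](sum_unit_average (fun u => e (dot c u)) kU).
apply: le_trans (ler_wpM2l (ler0n _ n) (ler_norm_sum _ _ _)) _.
rewrite mulr_sumr mulr_natr -sumr_const; apply: ler_sum => u /unit_pairsP Uu.
have Mc : (M * p)%:R * c.1 = 0 /\ (M * p)%:R * c.2 = 0.
  rewrite -[p in (M * p)%N]expn1; split; apply/eqP; rewrite -order_exp_le -c1.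
    exact: leq_maxl.
  exact: leq_maxr.
have p1 : p%:R * (eps * (c.1 * u.1)) = 0 by apply: peps; rewrite mulrA Mc.1 mul0r.
have p2 : p%:R * (eps * (c.2 * u.2)) = 0 by apply: peps; rewrite mulrA Mc.2 mul0r.
have [a Ea] := p_torsionP N_gt0 p_pr pN p1.
have [b Eb] := p_torsionP N_gt0 p_pr pN p2.
have ab0 : (a, b) != 0.
  apply/eqP => -[a0 b0].
  have t0 : torsion_embed 0 = 0 by exact: torsion_embed0.
  have T1 : M%:R * c.1 = 0.
    transitivity (M%:R * (eps * (c.1 * u.1)) * u.2); last by rewrite Ea a0 t0 mulr0 mul0r.
    by rewrite Meps -mulrA -[c.1 * _ * _]mulrA Uu mulr1.
  have T2 : M%:R * c.2 = 0.
    transitivity (M%:R * (eps * (c.2 * u.2)) * u.1); last by rewrite Eb b0 t0 mulr0 mul0r.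
    by rewrite Meps -mulrA -[c.2 * _ * _]mulrA [u.2 * _]mulrC Uu mulr1.
  move/eqP: T1; move/eqP: T2; rewrite -[M]muln1 -(expn0 p) -!order_exp_le.
  by move: c1; rewrite /max_order_exp; lia.
rewrite (eq_bigr (fun v => e (c.1 * u.1 - torsion_embed a + (c.2 * u.2 - torsion_embed b)) *
   zchar (w ^+ (N %/ p)) (dot (a, b) v))); last first.
  move=> v Uv; rewrite -(zchar_torsion_embed N_gt0 wP) //.
  rewrite -(charD eP) /dot /mulp /= (torsion_embedD N_gt0 p_pr pN).
  rewrite !(torsion_embedM N_gt0 p_pr pN) //.
  have [E1 _] := keps v Uv _ p1; have [_ E2] := keps v Uv _ p2.
  congr (zchar _ _); rewrite !mulrA E1 E2 Ea Eb; ring.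
rewrite -big_distrr normrM (char_norm eP) mul1r.
exact: prime_kloo_bound p_pr np (prim_root_torsion N_gt0 p_pr pN wP) ab0.
Qed.

Lemma kloo_large_prime (n : nat) (c : Zmod N * Zmod N) : (12 * n ^ 4 <= p.-1)%N ->
  (0 < max_order_exp c)%N -> n%:R * `|kloosterman e c| <= #|U|%:R.
Proof.
move=> np c0; have [c1|c2] := leqP (max_order_exp c) 1.
  by apply: kloo_shallow_bound => //; apply/eqP; rewrite eqn_leq c1.
have H := kloo_deep_bound c2.
have Up1 := leq_trans np (card_unit_pairs_prime p_pr).
have Up0 : 0 < #|Up|%:R :> algC by rewrite ltr0n card_unit_pairs_gt0.
rewrite -(ler_pM2l Up0) mulrCA.
apply: le_trans (ler_wpM2l (ler0n _ n) H) _.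
rewrite mulrA ler_wpM2r ?ler0n // -natrM ler_nat.
apply: leq_trans Up1; have [->//|n0] := posnP n.
by have : (n ^ 1 <= n ^ 4)%N by [rewrite leq_pexp2l]; lia.
Qed.

End LargePrime.

(** * Averages of Kloosterman sums along a geometric progression *)

Section Progression.

(** Where positive, a - i q is strictly decreasing in i and b - (s - i) q is
    strictly increasing, so each takes the value 1 at most once, and they
    agree at a positive value at most once. *)
Lemma card_exceptional (a b q s : nat) : (0 < q)%N ->
  (#|[set i : 'I_s.+1 |
     (maxn (a - i * q) (b - (s - i) * q) == 1) ||
     (a - i * q == b - (s - i) * q) && (0 < a - i * q)]%N| <= 3)%N.
Proof.
move=> q0.
pose A1 := [set i : 'I_s.+1 | (a - i * q == 1)%N].
pose A2 := [set i : 'I_s.+1 | (b - (s - i) * q == 1)%N].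
pose A3 := [set i : 'I_s.+1 | (a - i * q == b - (s - i) * q)%N && (0 < a - i * q)%N].
have sub : [set i : 'I_s.+1 |
     (maxn (a - i * q) (b - (s - i) * q) == 1) ||
     (a - i * q == b - (s - i) * q) && (0 < a - i * q)]%N \subset A1 :|: A2 :|: A3.
  apply/subsetP => i; rewrite !inE; move: (a - _)%N (b - _)%N => x y.
  by case/orP => [/eqP|->]; [rewrite /maxn; case: ifP => _ ->|]; rewrite ?eqxx ?orbT.
have uniq_mul (i j : nat) : (i * q = j * q)%N -> i = j.
  by move=> /eqP; rewrite eqn_pmul2r // => /eqP.
have c1 : (#|A1| <= 1)%N.
  apply/card_le1_eqP => i j; rewrite !inE => /eqP Hi /eqP Hj; apply/ord_inj/uniq_mul.
  by move: Hi Hj; lia.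
have c2 : (#|A2| <= 1)%N.
  apply/card_le1_eqP => i j; rewrite !inE => /eqP Hi /eqP Hj; apply/ord_inj.
  have /uniq_mul : ((s - i) * q = (s - j) * q)%N by lia.
  by have := ltn_ord i; have := ltn_ord j; lia.
have c3 : (#|A3| <= 1)%N.
  apply/card_le1_eqP => i j; rewrite !inE => /andP[/eqP Hi Hi0] /andP[/eqP Hj Hj0].
  apply/ord_inj/uniq_mul; move: Hi Hj Hi0 Hj0.
  have := ltn_ord i; have := ltn_ord j; rewrite !mulnBl => ltj lti.
  have : (i * q <= s * q)%N by rewrite leq_mul2r -ltnS lti orbT.
  have : (j * q <= s * q)%N by rewrite leq_mul2r -ltnS ltj orbT.
  by lia.
apply: leq_trans (subset_leq_card sub) _.
apply: leq_trans (leq_card_setU _ _).1 _; rewrite -[3%N]/(2 + 1)%N leq_add //.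
by apply: leq_trans (leq_card_setU _ _).1 _; rewrite -[2%N]/(1 + 1)%N leq_add.
Qed.

Lemma logn_fact_gt (p P : nat) : prime p -> (P < p)%N -> logn p P`! = 0%N.
Proof.
move=> p_pr; elim: P => [|P IH] Pp; first by rewrite logn1.
rewrite factS lognM ?fact_gt0 // IH 1?ltnW // addn0 lognE p_pr /=.
by rewrite gtnNdvd.
Qed.

Variables (N : nat) (w : algC).
Hypothesis N_gt0 : (0 < N)%N.
Hypothesis wP : N.-primitive_root w.
Notation e := (zchar w).
Notation eP := (zchar_faithful N_gt0 wP).
Notation U := (unit_pairs (Zmod N)).

(** The order of [x] divides N, and no prime divides it. *)
Lemma order_exp_all0 (x : Zmod N) : (forall p, prime p -> order_exp p N_gt0 x = 0%N) -> x = 0.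
Proof.
move=> H; apply/eqP; rewrite -[x]Zmod_valK Zmod_nat_eq0 //.
apply/(dvdn_partP _ N_gt0) => p; rewrite mem_primes => /andP[p_pr _].
have := H p p_pr; rewrite -[x]Zmod_valK => /eqP; rewrite -leqn0 order_exp_nat //.
by rewrite expn0 mul1n p_part Zmod_valK.
Qed.

Lemma max_order_exp_dvd p (c : Zmod N * Zmod N) : prime p ->
  (0 < max_order_exp p N_gt0 c)%N -> (p %| N)%N.
Proof.
by move=> p_pr; rewrite /max_order_exp leq_max => /orP[] /(order_exp_gt0_dvd p_pr).
Qed.

(** The pair of arguments of the Kloosterman sum contributed by the exponent i to
    a Fourier coefficient of the family of points. *)
Definition slide (Q s i : nat) (c : Zmod N * Zmod N) : Zmod N * Zmod N :=
  (c.1 * Q%:R ^+ i, c.2 * Q%:R ^+ (s - i)).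

Lemma kloo_ge (c : Zmod N * Zmod N) : - #|U|%:R <= kloosterman e c.
Proof.
apply: real_lerNnormlW; rewrite ?(kloo_real eP) //.
by apply: le_trans (ler_norm_sum _ _ _) _;
  under eq_bigr => u _ do rewrite (char_norm eP); rewrite sumr_const.
Qed.

(** The dichotomy at P.  A prime above P in the orders of [c] stays there for
    all i, since it does not divide P!, and makes every term small.  Without
    such a prime every term outside the exceptional set is nonnegative. *)
Lemma kloo_progression (n s : nat) (c : Zmod N * Zmod N) :
  let P := (12 * n ^ 4 + 1)%N in (3 * P.+1 * n <= s.+1)%N ->
  - (s.+1%:R * #|U|%:R) <= n%:R * \sum_(i < s.+1) kloosterman e (slide P`! s i c).
Proof.
move=> P sn; set Q := P`!.
have Q0 : (0 < Q)%N by rewrite fact_gt0.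
have topE p i : prime p -> max_order_exp p N_gt0 (slide Q s i c) =
    maxn (order_exp p N_gt0 c.1 - i * logn p Q) (order_exp p N_gt0 c.2 - (s - i) * logn p Q).
  by move=> p_pr; rewrite /max_order_exp /slide /= !order_exp_mulX.
have [/existsP[p /and3P[p_pr pP pc]]|] :=
  boolP [exists p : 'I_N.+1, [&& prime p, P < p & 0 < max_order_exp p N_gt0 c]%N].
  have q0 : logn p Q = 0%N by rewrite /Q logn_fact_gt.
  have pN := max_order_exp_dvd p_pr pc.
  have big_p : (12 * n ^ 4 <= p.-1)%N by move: pP; rewrite /P; lia.
  rewrite mulr_sumr mulr_natl -mulNrn -[s.+1 in leLHS]card_ord -sumr_const.
  apply: ler_sum => i _.
  (* p does not divide Q, so multiplication by Q preserves the exponent of p. *)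
  have pos : (0 < max_order_exp p N_gt0 (slide Q s i c))%N by rewrite topE // q0 !muln0 !subn0.
  have := kloo_large_prime p_pr wP pN big_p pos.
  rewrite -{1}[n%:R]normr_nat -normrM.
  by apply: real_lerNnormlW; rewrite realM ?realn ?(kloo_real eP).
rewrite negb_exists => /forallP large0.
have large p i : prime p -> (P < p)%N -> max_order_exp p N_gt0 (slide Q s i c) = 0%N.
  move=> p_pr pP; have c0 : max_order_exp p N_gt0 c = 0%N.
    apply/eqP; rewrite -leqn0 leqNgt; apply/negP => pc.
    have := dvdn_leq N_gt0 (max_order_exp_dvd p_pr pc); rewrite -ltnS => pN.
    by have := large0 (Ordinal pN); rewrite /= p_pr pP pc.
  by rewrite topE //; move: c0; rewrite /max_order_exp; lia.
pose bad (p : nat) : {set 'I_s.+1} := [set i : 'I_s.+1 |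
     (maxn (order_exp p N_gt0 c.1 - i * logn p Q)
           (order_exp p N_gt0 c.2 - (s - i) * logn p Q) == 1) ||
     (order_exp p N_gt0 c.1 - i * logn p Q == order_exp p N_gt0 c.2 - (s - i) * logn p Q)
     && (0 < order_exp p N_gt0 c.1 - i * logn p Q)]%N.
(* For p <= P the valuation of Q = P! at p is positive. *)
pose Bad := \bigcup_(p < P.+1 | prime p) bad p.
have cBad : (#|Bad| <= 3 * P.+1)%N.
  apply: (@leq_trans (\sum_(p < P.+1) 3)); last by rewrite sum_nat_const card_ord mulnC.
  rewrite [leqRHS](bigID (fun p : 'I_P.+1 => prime p)) /=.
  apply: leq_trans (leq_addr _ _).
  apply: (big_ind2 (fun (A : {set 'I_s.+1}) m => #|A| <= m)%N) => [|A x B y Ax By|p p_pr].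
  - by rewrite cards0.
  - exact: leq_trans (leq_card_setU A B).1 (leq_add Ax By).
  apply: card_exceptional; rewrite logn_gt0 mem_primes p_pr Q0 dvdn_fact //.
  by rewrite prime_gt0 // -ltnS /=.
have good (i : 'I_s.+1) : i \notin Bad -> 0 <= kloosterman e (slide Q s i c).
  move=> iBad.
  have [/existsP[p /andP[p_pr pc]]|] :=
    boolP [exists p : 'I_P.+1, prime p && (0 < max_order_exp p N_gt0 (slide Q s i c))%N].
    have : i \notin bad p by apply: contra iBad => Hi; apply/bigcupP; exists p.
    rewrite in_set negb_or negb_and => /andP[top1 neq].
    rewrite (@kloo_vanish_exp N p N_gt0) //.
      by move: pc top1; rewrite topE //; lia.
    rewrite !order_exp_mulX //; move: pc neq; rewrite topE //.
    move: (_ - _)%N (_ - _)%N => x y xy /orP[//|]; apply: contra => /eqP E.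
    by move: xy; rewrite E maxnn.
  rewrite negb_exists => /forallP small.
  have top0 p : prime p -> max_order_exp p N_gt0 (slide Q s i c) = 0%N.
    move=> p_pr; have [pP|] := leqP p P; last exact: large.
    have := small (Ordinal (pP : p < P.+1)%N); rewrite /= p_pr /= -leqNgt leqn0.
    by move/eqP.
  (* All orders are trivial, so the sum counts the units. *)
  have -> : slide Q s i c = 0.
    rewrite [LHS]surjective_pairing; congr (_, _); apply: order_exp_all0 => p /top0;
      rewrite /max_order_exp; lia.
  by rewrite (kloo0 eP) ler0n.
have term (i : 'I_s.+1) : - (if i \in Bad then #|U|%:R else 0) <= kloosterman e (slide Q s i c).
  by case: ifPn => [_|/good]; rewrite ?oppr0 //; apply: kloo_ge.
have le1 : - (#|Bad|%:R * #|U|%:R) <= \sum_(i < s.+1) kloosterman e (slide Q s i c).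
  rewrite mulr_natl -sumr_const big_mkcond /= -sumrN.
  by apply: ler_sum => i _; apply: term.
apply: le_trans (ler_wpM2l (ler0n _ n) le1).
rewrite mulrN lerN2 mulrA ler_wpM2r ?ler0n // -natrM ler_nat.
by apply: leq_trans sn; rewrite mulnC leq_mul2r cBad orbT.
Qed.

End Progression.

(** * From Fourier coefficients to differences *)

Section Spectral.

(** The sum over all frequencies counts, up to the factor #|R|^2, the solutions of
    [v i + a - b = 0] with a, b in [E]. *)
Lemma diffset_hit (R : finComPzRingType) (e : R -> algC) (I : finType)
    (A : {set I}) (v : I -> R * R) (E : {set R * R}) :
  faithful_char e ->
  (forall i a b, i \in A -> a \in E -> b \in E -> v i != a - b) ->
  \sum_xi (\sum_(i in A) e (dot xi (v i)))
          * `|\sum_(a in E) e (dot xi a)| ^+ 2 = 0.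
Proof.
move=> eP miss.
under eq_bigr => xi _.
  rewrite normCK rmorph_sum big_distrlr /= pair_big /= big_distrlr /= pair_big /=.
  under eq_bigr => t _.
    rewrite -(charN eP) -[e (dot xi t.2.1) * _](charD eP) -[e _ * _](charD eP).
    rewrite -dotBr -dotDr.
    over.
  over.
rewrite exchange_big /=; apply: big1 => -[i [a b]] /= /andP[Ai /andP[Ea Eb]].
rewrite (char_sum_dot eP) (_ : _ == 0 = false) //.
by apply/negbTE; rewrite addr_eq0 opprB; apply: miss.
Qed.

(** In the vanishing sum of [diffset_hit] the zero frequency contributes
    #|A| #|E|^2, and the others at least -(#|A| / n) (#|R|^2 #|E| - #|E|^2) by
    hypothesis and Parseval; the total is positive at this density. *)
Lemma diffset_spectral (R : finComPzRingType) (e : R -> algC) (I : finType)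
    (A : {set I}) (v : I -> R * R) (E : {set R * R}) (n : nat) :
  faithful_char e -> (0 < #|A|)%N ->
  (forall xi, - #|A|%:R <= n%:R * \sum_(i in A) e (dot xi (v i))) ->
  (#|R| ^ 2 < n.+1 * #|E|)%N ->
  exists i a b, [/\ i \in A, a \in E, b \in E & v i = a - b].
Proof.
move=> eP A0 low dens.
have [/existsP[i /existsP[a /existsP[b /and4P[Ai Ea Eb /eqP ?]]]]|] :=
  boolP [exists i, [exists a, [exists b, [&& i \in A, a \in E, b \in E & v i == a - b]]]].
  by exists i, a, b.
rewrite negb_exists => /forallP no.
have miss i a b : i \in A -> a \in E -> b \in E -> v i != a - b.
  move=> Ai Ea Eb; apply: contra (no i) => H; apply/existsP; exists a; apply/existsP.
  by exists b; apply/and4P.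
have Z := diffset_hit eP miss.
have En := energy_identity eP E id.
have diag : #|[set t in setX E E | t.1 == t.2]| = #|E|.
  rewrite -(card_imset _ (_ : injective (fun a : R * R => (a, a)))); last by move=> a b [].
  apply: eq_card => -[a b]; rewrite in_set in_setX /=.
  apply/idP/imsetP => [/andP[/andP[Ea _] /eqP <-]|[c Ec [-> ->]]].
    by exists a.
  by rewrite Ec eqxx.
rewrite diag in En.
pose K xi := \sum_(i in A) e (dot xi (v i)).
pose F xi := `|\sum_(a in E) e (dot xi a)| ^+ 2.
have dot0 u : dot 0 u = 0 :> R by rewrite /dot /= !mul0r addr0.
have K0 : K 0 = #|A|%:R.
  by rewrite /K; under eq_bigr => i _ do rewrite dot0 (char0 eP); rewrite sumr_const.
have F0 : F 0 = #|E|%:R ^+ 2.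
  rewrite /F; under eq_bigr => i _ do rewrite dot0 (char0 eP).
  by rewrite sumr_const normr_nat.
have Fge0 xi : 0 <= F xi by rewrite exprn_ge0.
have sumF : \sum_(xi : R * R | xi != 0) F xi = #|R|%:R ^+ 2 * #|E|%:R - #|E|%:R ^+ 2.
  apply/eqP; rewrite -En -F0 eq_sym subr_eq (bigD1 (0 : R * R)) //= addrC; exact: eqxx.
have key : n%:R * #|A|%:R * #|E|%:R ^+ 2 +
    - #|A|%:R * (#|R|%:R ^+ 2 * #|E|%:R - #|E|%:R ^+ 2) <= 0 :> algC.
  rewrite -[leRHS](mulr0 n%:R) -Z mulr_sumr (bigD1 (0 : R * R)) //=.
  rewrite -/(K 0) -/(F 0) K0 F0 mulrA lerD2l -sumF mulr_sumr.
  by apply: ler_sum => xi _; rewrite mulrA -/(F xi); apply: ler_wpM2r; [exact: Fge0 | exact: low].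
have E0 : (0 < #|E|)%N by case: #|E| dens => //; rewrite muln0.
have : #|A|%:R * #|E|%:R * (n.+1%:R * #|E|%:R - #|R|%:R ^+ 2) <= 0 :> algC.
  rewrite (_ : _ * (_ - _) = n%:R * #|A|%:R * #|E|%:R ^+ 2 +
    - #|A|%:R * (#|R|%:R ^+ 2 * #|E|%:R - #|E|%:R ^+ 2)) // -addn1 natrD; ring.
rewrite -natrM pmulr_rle0 ?ltr0n ?muln_gt0 ?A0 // subr_le0 -natrM -natrX ler_nat.
by rewrite leqNgt dens.
Qed.

Variables (N : nat).
Hypothesis N_gt0 : (0 < N)%N.

(** The points (x + y, y - x) with x = Q^i l, y = Q^(s - i) m l^-1 satisfy the
    hypothesis of [diffset_spectral] by [kloo_progression]: at the frequency
    (a, b) the phase is (a - b) x + (a + b) y. *)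
Lemma diffset_multiples (n s : nat) (E : {set Zmod N * Zmod N}) (m : Zmod N) :
  let P := (12 * n ^ 4 + 1)%N in (3 * P.+1 * n <= s.+1)%N ->
  (N ^ 2 < n.+1 * #|E|)%N ->
  exists2 z, z \in diffset E & z.1 ^+ 2 - z.2 ^+ 2 = (4 * P`! ^ s)%:R * m.
Proof.
move=> P sn dens; set Q := P`!.
have [w wP] := C_prim_root_exists N_gt0.
have eP := zchar_faithful N_gt0 wP.
pose U := unit_pairs (Zmod N).
pose x (t : 'I_s.+1 * (Zmod N * Zmod N)) : Zmod N := Q%:R ^+ t.1 * t.2.1.
pose y (t : 'I_s.+1 * (Zmod N * Zmod N)) : Zmod N := Q%:R ^+ (s - t.1) * m * t.2.2.
pose v t := (x t + y t, y t - x t).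
pose A := setX [set: 'I_s.+1] U.
have cA : #|A| = (s.+1 * #|U|)%N by rewrite cardsX cardsT card_ord.
have A0 : (0 < #|A|)%N by rewrite cA muln_gt0 card_unit_pairs_gt0.
have low xi : - #|A|%:R <= n%:R * \sum_(t in A) zchar w (dot xi (v t)).
  pose c : Zmod N * Zmod N := (xi.1 - xi.2, (xi.1 + xi.2) * m).
  rewrite (_ : \sum_(t in A) _ = \sum_(i < s.+1) kloosterman (zchar w) (slide Q s i c)).
    by rewrite cA natrM; apply: kloo_progression.
  rewrite /kloosterman pair_big /=; apply: eq_big => [[i u]|[i u] _].
    by rewrite in_setX in_setT.
  by congr (zchar w _); rewrite /dot /slide /v /x /y /=; ring.
have [|[i u] [a [b [+ Ea Eb vE]]]] := diffset_spectral eP A0 low (E := E).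
  by rewrite card_Zmod.
rewrite in_setX /= => /andP[_ /unit_pairsP Uu].
exists (v (i, u)); first by rewrite vE; apply/imset2P; exists a b.
have i_s : (i <= s)%N by rewrite -ltnS.
transitivity (4%:R * (Q%:R ^+ i * Q%:R ^+ (s - i)) * m * (u.1 * u.2)).
  by rewrite /v /x /y /=; ring.
by rewrite Uu mulr1 -exprD subnKC // natrM natrX.
Qed.

End Spectral.

(** * Values of the form on a difference set *)

(** Bezout: gcd(D, N) is a multiple of D modulo N. *)
Lemma multiples_gcd (N D : nat) (N_gt0 : (0 < N)%N) (x : Zmod N) :
  exists y : Zmod N, (gcdn D N)%:R * x = D%:R * y.
Proof.
have [->|D0] := posnP D.
  exists 0; rewrite gcd0n mulr0.
  by have /eqP -> : (N%:R : Zmod N) == 0; [rewrite Zmod_nat_eq0 | rewrite mul0r].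
have [u v E _] := egcdnP N D0.
exists (u%:R * x); rewrite mulrA -natrM mulnC E natrD natrM.
by have /eqP -> : (N%:R : Zmod N) == 0; [rewrite Zmod_nat_eq0|rewrite mulr0 add0r].
Qed.

Theorem corollary1p11 (R : realType) (delta : R) (delta_gt0 : 0 < delta) :
  exists2 K : nat, (1 <= K)%N &
    forall (N : nat) (N_gt0 : (1 <= N)%N) (E : {set Zmod N * Zmod N}),
      delta * N%:R ^+ 2 <= #|E|%:R ->
      exists d : nat,
        [/\ (0 < d)%N, (d %| N)%N, (d <= K)%N &
            multiples N d \subset
              [set w.1 ^+ 2 - w.2 ^+ 2 | w in diffset E]].
Proof.
(* The constants: n + 1 > 1 / delta, then P beats the fourth moment bound,
   and s makes the exceptional exponents a proportion at most 1 / n. *)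
pose n := Num.bound delta^-1.
have n_delta : delta^-1 < n%:R by rewrite archi_boundP // invr_ge0 ltW.
pose P := (12 * n ^ 4 + 1)%N; pose s := (3 * P.+1 * n)%N.
pose K := (4 * P`! ^ s)%N.
have K0 : (0 < K)%N by rewrite muln_gt0 expn_gt0 fact_gt0.
exists K => // N N_gt0 E dens.
have dens_nat : (N ^ 2 < n.+1 * #|E|)%N.
  rewrite -(ltr_nat R) natrX natrM.
  have N2 : 0 < N%:R ^+ 2 :> R by rewrite exprn_gt0 // ltr0n.
  have lt1 : 1 < n.+1%:R * delta.
    rewrite -ltr_pdivrMr // mul1r.
    by apply: lt_trans n_delta _; rewrite ltr_nat.
  apply: lt_le_trans (ler_wpM2l (ler0n R n.+1) dens).
  by rewrite mulrA -[ltLHS]mul1r ltr_pM2r.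
exists (gcdn K N); split.
- by rewrite gcdn_gt0 K0.
- exact: dvdn_gcdr.
- by rewrite dvdn_leq // dvdn_gcdl.
apply/subsetP => _ /imsetP[x _ ->].
have [y ->] := multiples_gcd K N_gt0 x.
have [z zE zK] := diffset_multiples N_gt0 y (leqnSn s) dens_nat.
by apply/imsetP; exists z.
Qed.
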